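(* Let $Z,E$ be Banach spaces, $f=(f_1,\dots,f_m)\colon Z\to\mathbb{R}^m$ and $G\colon Z\to E$ of class $C^2$, $Q\subset E$ nonempty closed convex, and consider (MP1): minimize $f(z)$ with respect to $\mathbb{R}^m_+$ subject to $G(z)\in Q$, with feasible set $\Sigma$. Let $\bar z\in\Sigma$ satisfy the Robinson constraint qualification $0\in\mathrm{int}\,[\nabla G(\bar z)(B_Z)-(Q-G(\bar z))\cap B_E]$, and suppose $\bar z$ is a locally weak Pareto solution of (MP1). Then for each $d\in\mathcal{C}_{1*}(\bar z)$ there exists $(\lambda,e^* )\in\Lambda_1(\bar z)$ such that $\nabla^2_{zz}\mathcal{L}_1(\bar z,\lambda,e^* )(d,d)\ge0$, where $\mathcal{L}_1(z,\lambda,e^* )=\sum_{i=1}^m\lambda_if_i(z)+\langle e^*,G(z)\rangle$.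
   Context: $B_Z,B_E$ closed unit balls. $\bar z$ is a locally weak Pareto solution if there is $\epsilon>0$ with $f(z)-f(\bar z)\notin-\mathrm{int}\,\mathbb{R}^m_+$ for all $z\in\Sigma$ with $\|z-\bar z\|\le\epsilon$. $\mathrm{cone}(Q-G(\bar z))=\{\mu(q-G(\bar z)):q\in Q,\mu>0\}$. $\mathcal{C}_{01}(\bar z)=\{d\in Z:\nabla f(\bar z)d\in-\mathbb{R}^m_+,\ \nabla G(\bar z)d\in\mathrm{cone}(Q-G(\bar z))\}$ and $\mathcal{C}_{1*}(\bar z)$ is its closure in $Z$. $\Lambda_1(\bar z)=\{(\lambda,e^* )\in\mathbb{R}^m_+\times E^*:\sum_i\lambda_i\nabla f_i(\bar z)+\nabla G(\bar z)^*e^*=0,\ |\lambda|=1,\ e^*\in N(Q;G(\bar z))\}$, where $N(Q;\bar e)=\{e^*:\langle e^*,e-\bar e\rangle\le0\ \forall e\in Q\}$. *)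

(* Defs.v *)
From HB Require Import structures.
From mathcomp Require Import all_boot all_order all_algebra.
From mathcomp Require Import all_classical all_reals all_analysis.
Set Implicit Arguments. Unset Strict Implicit. Unset Printing Implicit Defensive.
Import Order.TTheory GRing.Theory Num.Theory.
Import numFieldNormedType.Exports.
Local Open Scope classical_set_scope.
Local Open Scope ring_scope.

Section Defs.
Variable R : realType.

Definition dual_elt (E : normedModType R) (e : E -> R) : Prop :=
  (forall a x y, e (a *: x + y) = a * e x + e y) /\ continuous e.

Definition C2_with (Z E : normedModType R) (F : Z -> E)
    (DF : Z -> Z -> E) (D2F : Z -> Z -> Z -> E) : Prop :=
  (forall z, differentiable F z /\ forall v, 'd F z v = DF z v) /\
  (forall z a u u' v, D2F z (a *: u + u') v = a *: D2F z u v + D2F z u' v) /\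
  (forall z a u v v', D2F z u (a *: v + v') = a *: D2F z u v + D2F z u v') /\
  (forall z, exists M : R, forall u v, `|D2F z u v| <= M * `|u| * `|v|) /\
  (* z |-> DF z is Frechet differentiable (operator norm) with derivative D2F *)
  (forall z (eps : R), 0 < eps -> exists2 delta : R, 0 < delta &
     forall h, `|h| < delta -> forall v,
       `|DF (z + h) v - DF z v - D2F z h v| <= eps * `|h| * `|v|) /\
  (* z |-> D2F z is continuous (operator norm of bilinear maps) *)
  (forall z (eps : R), 0 < eps -> exists2 delta : R, 0 < delta &
     forall z', `|z' - z| < delta -> forall u v,
       `|D2F z' u v - D2F z u v| <= eps * `|u| * `|v|).

Definition normal_cone (E : normedModType R) (Q : set E) (eb : E)
    (e : E -> R) : Prop :=
  dual_elt e /\ forall q, Q q -> e (q - eb) <= 0.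

Definition cone_of (E : normedModType R) (Q : set E) (eb : E) : set E :=
  [set y | exists q, exists mu : R, Q q /\ 0 < mu /\ y = mu *: (q - eb)].

Definition feasible (Z E : normedModType R) (G : Z -> E) (Q : set E) : set Z :=
  [set z | Q (G z)].

Definition loc_weak_pareto (Z E : normedModType R) (m : nat)
    (f : 'I_m -> Z -> R) (G : Z -> E) (Q : set E) (zb : Z) : Prop :=
  exists2 eps : R, 0 < eps & forall z, feasible G Q z -> `|z - zb| <= eps ->
    ~ (forall i : 'I_m, f i z - f i zb < 0).

Definition robinson_cq (Z E : normedModType R) (DG : Z -> E) (Q : set E)
    (Gzb : E) : Prop :=
  interior
    [set y : E | exists z : Z, exists q : E, `|z| <= 1 /\ Q q /\
                 `|q - Gzb| <= 1 /\ y = DG z - (q - Gzb)] (0 : E).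

(* C_{01}(zb) with Df i = grad f_i(zb), DG = grad G(zb) *)
Definition C01 (Z E : normedModType R) (m : nat) (Df : 'I_m -> Z -> R)
    (DG : Z -> E) (Q : set E) (Gzb : E) : set Z :=
  [set d | (forall i, Df i d <= 0) /\ cone_of Q Gzb (DG d)].

Definition C1star (Z E : normedModType R) (m : nat) (Df : 'I_m -> Z -> R)
    (DG : Z -> E) (Q : set E) (Gzb : E) : set Z :=
  closure (C01 Df DG Q Gzb).

Definition Lambda1 (Z E : normedModType R) (m : nat) (Df : 'I_m -> Z -> R)
    (DG : Z -> E) (Q : set E) (Gzb : E) (lam : 'I_m -> R) (e : E -> R) : Prop :=
  (forall i, 0 <= lam i) /\
  (forall v, \sum_(i < m) lam i * Df i v + e (DG v) = 0) /\
  Num.sqrt (\sum_(i < m) lam i ^+ 2) = 1 /\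
  normal_cone Q Gzb e.

Definition hess_L1 (Z E : normedModType R) (m : nat)
    (D2f : 'I_m -> Z -> Z -> R) (D2G : Z -> Z -> E)
    (lam : 'I_m -> R) (e : E -> R) (u v : Z) : R :=
  \sum_(i < m) lam i * D2f i u v + e (D2G u v).

End Defs.

(* Main.v *)
Require Import Defs.
From HB Require Import structures.
From mathcomp Require Import all_boot all_order all_algebra.
From mathcomp Require Import all_classical all_reals all_analysis.
From mathcomp Require Import ring lra.
Import Order.TTheory GRing.Theory Num.Theory.
Import numFieldNormedType.Exports.
Local Open Scope classical_set_scope.
Local Open Scope ring_scope.

(** Primal form: if [d] lies in the closed critical cone, no triple [(w, s, q)] with
    [s > 0] and [q] in [Q] makes [DG w + D2G(d,d)/2 = s (q - G zb)] while all
    [Df_i w + D2f_i(d,d)/2] are negative. Otherwise (for [d] in the cone itself)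
    the parabola [zb + t d + t^2 w] is feasible up to [o(t^2)]; Robinson's
    condition, through a Newton-like iteration, moves it back into the feasible
    set at cost [o(t^2)], where every [f_i] is smaller than at [zb].
    Dual form: the primal statement says that a convex cone in [R^m * E] misses
    the origin. Robinson's condition gives this cone an algebraic interior point,
    so a nonzero linear functional [(lam, e)] is nonnegative on it; the same
    condition yields continuity of [e] and [lam <> 0]. *)

Set Implicit Arguments.
Unset Strict Implicit.
Unset Printing Implicit Defensive.

(** * Algebraic separation of the origin from a convex cone with an algebraic interior point *)

Section ConeSeparation.
Variables (R : realType) (X : lmodType R).

Definition convex_cone (K : set X) : Prop :=
  [/\ K 0, forall x y, K x -> K y -> K (x + y)
    & forall (a : R) x, 0 <= a -> K x -> K (a *: x)].

(** Zorn's lemma yields a cone maximal among those that contain [K0] and avoid [- a0]. Adjoining an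
    [x] outside it must capture [- a0], and this forces [- x] into the cone. *)
Lemma maximal_cone (K0 : set X) (a0 : X) :
  convex_cone K0 -> K0 a0 -> ~ K0 (- a0) ->
  exists K, [/\ convex_cone K, K0 `<=` K, ~ K (- a0)
    & forall x, K x \/ K (- x)].
Proof.
move=> K0cone K0a0 K0N.
pose P (K : set X) :=
  K = set0 \/ [/\ convex_cone K, K0 `<=` K & ~ K (- a0)].
have [F FP Ftot|K [PK Kmax]] := @Zorn_bigcup X P.
  have [[K1 FK1 [x1 K1x1]]|F0] := pselect (exists2 K, F K & K !=set0); last first.
    left; apply/seteqP; split=> // x [K FK Kx].
    by apply: F0; exists K => //; exists x.
  have PF K x : F K -> K x -> [/\ convex_cone K, K0 `<=` K & ~ K (- a0)].
    by move=> FK Kx; case: (FP _ FK) => // K00; rewrite K00 in Kx.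
  have [[K10 _ _] K01 _] := PF _ _ FK1 K1x1.
  right; split; last by move=> [K FK Kx]; have [] := PF _ _ FK Kx.
  - split; first by exists K1.
    + move=> x y [K FK Kx] [L FL Ly].
      have [[_ KD _] _ _] := PF _ _ FK Kx.
      have [[_ LD _] _ _] := PF _ _ FL Ly.
      have [KL|LK] := Ftot _ _ FK FL.
        by exists L => //; apply: LD => //; exact: KL.
      by exists K => //; apply: KD => //; exact: LK.
    + move=> a x a_ge0 [K FK Kx]; exists K => //.
      by have [[_ _ KZ] _ _] := PF _ _ FK Kx; exact: KZ.
  - by move=> x K0x; exists K1 => //; exact: K01.
have K0K : K !=set0.
  apply/set0P/eqP => K_eq0; apply: (Kmax K0); last by right; split.
  rewrite K_eq0; split=> // /(_ a0 K0a0); exact.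
case: PK => [K_eq0|[Kcone K0_sub KN]]; first by case: K0K => x; rewrite K_eq0.
have [Kz KD KZ] := Kcone.
exists K; split=> // x; have [Kx|nKx] := pselect (K x); [by left|right].
pose K' : set X := [set y | exists k t, [/\ K k, 0 <= t & y = k + t *: x]].
have subK : K `<=` K' by move=> k Kk; exists k, 0; rewrite scale0r addr0.
have [] := pselect (K' (- a0)); last first.
  move=> nK'; exfalso; apply: (Kmax K'); last first.
    right; split=> //; last by move=> y /K0_sub /subK.
    split; first exact: subK.
      move=> _ _ [k [t [Kk t0 ->]]] [l [u [Kl u0 ->]]].
      exists (k + l), (t + u); split; [exact: KD|exact: addr_ge0|].
      by rewrite scalerDl addrACA.
    move=> a _ a0' [k [t [Kk t0 ->]]]; exists (a *: k), (a * t).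
    by split; [exact: KZ|exact: mulr_ge0|rewrite scalerDr scalerA].
  split=> // /(_ x) K'x; apply/nKx/K'x.
  by exists 0, 1; rewrite scale1r add0r.
(* Here [- a0 = k + t x]. Since [K] avoids [- a0], [t] is not 0, and solving for [- x] gives
   [t^-1 (k + a0)]. *)
move=> [k [t [Kk t0 a0E]]].
have tgt0 : 0 < t.
  rewrite lt_def t0 andbT; apply/eqP => t_eq0; apply: KN.
  by rewrite a0E t_eq0 scale0r addr0.
have -> : - x = t^-1 *: (k + a0).
  by rewrite -[a0]opprK a0E opprD addrA subrr sub0r scalerN scalerA mulVf ?scale1r ?gt_eqF.
apply: KZ; first by rewrite invr_ge0 ltW.
by apply: KD => //; exact: K0_sub.
Qed.

(* The functional sends [x] to the unique [r] with [x - (r - e) a0] and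
   [(r + e) a0 - x] in a maximal cone for all [e > 0]. *)
Lemma cone_separation (C : set X) (a0 : X) :
  (forall x y, C x -> C y -> C (x + y)) ->
  (forall (a : R) x, 0 < a -> C x -> C (a *: x)) ->
  ~ C 0 -> (forall x, exists2 t : R, 0 < t & C (a0 + t *: x)) ->
  exists phi : X -> R, [/\ forall a x y, phi (a *: x + y) = a * phi x + phi y,
    forall x, C x -> 0 <= phi x & phi a0 = 1].
Proof.
move=> CD CZ C0 core.
have Ca0 : C a0 by have [t _] := core 0; rewrite scaler0 addr0.
have [||| K [[K0 KD KZ] K0K KN Ktot]] := @maximal_cone (C `|` [set 0]) a0.
- split; first by right.
    move=> x y [Cx|->] [Cy|->]; rewrite ?addr0 ?add0r; [left|left|left|right] => //.
    exact: CD.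
  move=> a x; rewrite le_eqVlt => /predU1P[<- _|a_gt0 [Cx|->]].
  + by right; rewrite scale0r.
  + by left; exact: CZ.
  + by right; rewrite scaler0.
- by left.
- case=> [CNa0|/eqP]; first by apply: C0; rewrite -(subrr a0); exact: CD.
  by rewrite oppr_eq0 => /eqP a00; apply: C0; rewrite -a00.
have CK x : C x -> K x by move=> Cx; apply: K0K; left.
have Ka0 : K a0 := CK _ Ca0.
have KNa0 (a : R) : a < 0 -> ~ K (a *: a0).
  move=> a_lt0 Ka; apply: KN.
  have := KZ (- a)^-1 _ _ Ka; rewrite scalerA.
  rewrite invrN mulNr mulVf ?lt_eqF// scaleN1r; apply.
  by rewrite oppr_ge0 invr_le0 ltW.
have shift (x : X) (s t : R) : s <= t -> K (x - t *: a0) -> K (x - s *: a0).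
  move=> st Kx; have -> : x - s *: a0 = (x - t *: a0) + (t - s) *: a0.
    by rewrite scalerBl addrA subrK.
  by apply: KD => //; apply: KZ => //; rewrite subr_ge0.
pose D x r := forall e : R, 0 < e ->
  K (x - (r - e) *: a0) /\ K ((r + e) *: a0 - x).
(* [r] is the supremum of the [t] with [x - t a0] in [K]. The hypothesis [core] at [x] makes this
   set nonempty, and at [- x] bounded above; totality of [K] then puts [(r + e) a0 - x] in [K]. *)
have Dex x : exists r, D x r.
  pose S : set R := [set t | K (x - t *: a0)].
  have S0 : S !=set0.
    have [t t0 Ct] := core x; exists (- t^-1); rewrite /S/= scaleNr opprK.
    have -> : x + t^-1 *: a0 = t^-1 *: (a0 + t *: x).
      by rewrite scalerDr scalerA mulVf ?gt_eqF// scale1r addrC.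
    by apply: KZ; [rewrite invr_ge0 ltW|exact: CK].
  have Sub : has_ubound S.
    have [t t0 Ct] := core (- x); exists t^-1 => u Su; rewrite leNgt; apply/negP => tu.
    apply: (@KNa0 (t^-1 - u)); first by rewrite subr_lt0.
    have -> : (t^-1 - u) *: a0 = t^-1 *: (a0 + t *: - x) + (x - u *: a0).
      rewrite scalerDr scalerA mulVf ?gt_eqF// scale1r addrA subrK.
      by rewrite scalerBl.
    by apply: KD => //; apply: KZ; [rewrite invr_ge0 ltW|exact: CK].
  exists (sup S) => e e0; split.
    have [u Su] := sup_adherent e0 (conj S0 Sub).
    by move=> /ltW ru; exact: shift ru Su.
  have [Kx|] := Ktot (x - (sup S + e) *: a0); last by rewrite opprB.
  have := ub_le_sup Sub Kx; rewrite leNgt => /negP; case.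
  by rewrite ltrDl.
have Dle x r s : D x r -> D x s -> s <= r.
  move=> Dr Ds; rewrite leNgt; apply/negP => rs.
  have e0 : 0 < (s - r) / 4 by rewrite divr_gt0// subr_gt0.
  have [_ Kr] := Dr _ e0; have [Ks _] := Ds _ e0.
  apply: (@KNa0 ((r + (s - r) / 4) - (s - (s - r) / 4))); first by lra.
  by have := KD _ _ Kr Ks; rewrite addrA subrK -scalerBl.
have Dinj x r s : D x r -> D x s -> r = s.
  by move=> Dr Ds; apply/eqP; rewrite eq_le (Dle x)//= (Dle x).
have DD x y r s : D x r -> D y s -> D (x + y) (r + s).
  move=> Dr Ds e e0; have e20 : 0 < e / 2 by rewrite divr_gt0.
  have [Kx1 Kx2] := Dr _ e20; have [Ky1 Ky2] := Ds _ e20; split.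
    have := KD _ _ Kx1 Ky1; congr (K _).
    rewrite addrACA -opprD -scalerDl; congr (_ - _ *: _); lra.
  have := KD _ _ Kx2 Ky2; congr (K _).
  rewrite addrACA -opprD -scalerDl; congr (_ *: _ - _); lra.
have DZ a x r : 0 < a -> D x r -> D (a *: x) (a * r).
  move=> a_gt0 Dr e e0; have [Kx1 Kx2] := Dr (e / a) (divr_gt0 e0 a_gt0).
  have aE : a * (e / a) = e by rewrite mulrCA divff ?gt_eqF// mulr1.
  split.
    have := KZ _ _ (ltW a_gt0) Kx1; congr (K _).
    by rewrite scalerBr scalerA mulrBr aE.
  have := KZ _ _ (ltW a_gt0) Kx2; congr (K _).
  by rewrite scalerBr scalerA mulrDr aE.
have DN x r : D x r -> D (- x) (- r).
  move=> Dr e e0; have [Kx1 Kx2] := Dr e e0; split.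
    by rewrite -[- r - e]opprD scaleNr opprK addrC.
  by rewrite opprK [- r + e]addrC -[e - r]opprB scaleNr addrC.
have D0 : D 0 0.
  by move=> e e0; rewrite !sub0r add0r subr0 scaleNr opprK; split;
    by apply: KZ => //; exact: ltW.
have [phi phiP] := choice Dex.
exists phi; split.
- move=> a x y; apply: (Dinj (a *: x + y)) => //; apply: DD => //.
  have [a_lt0|a_gt0|->] := ltgtP a 0; last by rewrite scale0r mul0r.
    rewrite -[a]opprK scaleNr [(- - a) * _]mulNr; apply/DN/DZ => //.
    by rewrite oppr_gt0.
  exact: DZ.
- move=> x Cx; rewrite leNgt; apply/negP => phi_lt0.
  have e0 : 0 < - phi x / 2 by rewrite divr_gt0// oppr_gt0.
  have [_ Kx] := phiP x _ e0.
  apply: (@KNa0 (phi x + - phi x / 2)); first by lra.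
  by have := KD _ _ Kx (CK _ Cx); rewrite subrK.
- apply: (Dinj a0) => // e e0; split.
    rewrite -[X in X - _]scale1r -scalerBl opprB addrC subrK.
    by apply: KZ => //; exact: ltW.
  rewrite -[X in _ - X]scale1r -scalerBl addrC addKr.
  by apply: KZ => //; exact: ltW.
Qed.
End ConeSeparation.

(** * A theorem of the alternative producing normalized multipliers *)

Section MultiplierRule.
Variable R : realType.

(** This isolates one coefficient of a cone inequality by sending its free scalar to infinity. *)
Lemma slope_ge0 (c x : R) : (forall n : R, 0 < n -> 0 <= c + n * x) -> 0 <= x.
Proof.
move=> H; rewrite leNgt; apply/negP => x0.
have n0 : 0 < (`|c| + 1) / - x.
  by rewrite divr_gt0// ?oppr_gt0// ltr_wpDl.
have := H _ n0; rewrite invrN mulrN mulNr divfK ?lt_eqF//.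
have := ler_norm c; lra.
Qed.

(** A linear functional is odd, so a lower bound on a ball also bounds its absolute value there. *)
Lemma linear_lower_bound_continuous (E : normedModType R) (e : E -> R) (r c : R) :
  (forall a x y, e (a *: x + y) = a * e x + e y) ->
  0 < r -> (forall y, `|y| < r -> - c <= e y) -> continuous e.
Proof.
move=> eL r0 ec.
have e0 : e 0 = 0 by have := eL 1 0 0; rewrite scale1r addr0 mul1r; lra.
have eN y : e (- y) = - e y by rewrite -scaleN1r -[_ *: _]addr0 eL e0 addr0 mulN1r.
pose el : {linear E -> R^o} := HB.pack e (GRing.isLinear.Build R E R^o *:%R e eL).
apply: (@bounded_linear_continuous R E R^o el); apply/ex_bound; exists c.
apply/nbhs_norm0P; exists r => //= y yr.
suff : `|e y| <= c by [].
by rewrite ler_norml ec//= -lerN2 -eN ec ?normrN//.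
Qed.

(** The point [r] is the convex combination of [p] and [q] with weights [s / (s + t)] and
    [t / (s + t)]. Thus the cone over [Q - g] is closed under addition. *)
Lemma convex_ray_sum (E : lmodType R) (Q : set E) (g : E) :
  (forall x y (t : R), Q x -> Q y -> 0 <= t -> t <= 1 ->
    Q (t *: x + (1 - t) *: y)) ->
  forall (s t : R) p q, 0 < s -> 0 < t -> Q p -> Q q ->
    exists2 r, Q r & s *: (p - g) + t *: (q - g) = (s + t) *: (r - g).
Proof.
move=> Qcvx s t p q s0 t0 Qp Qq; have st0 := addr_gt0 s0 t0.
exists ((s / (s + t)) *: p + (1 - s / (s + t)) *: q).
  apply: Qcvx => //; first by rewrite ltW// divr_gt0.
  by rewrite ler_pdivrMr// mul1r lerDl ltW.
rewrite !scalerBr scalerDr !scalerA mulrBr mulr1 mulrCA divff ?gt_eqF// mulr1.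
by rewrite [s + t - s]addrC addKr scalerDl opprD addrACA.
Qed.

Lemma multiplier_rule (Z E : normedModType R) m
    (A : 'I_m -> Z -> R) (a : 'I_m -> R) (B : Z -> E) (b : E)
    (Q : set E) (g : E) (rho : R) :
  (forall i c x y, A i (c *: x + y) = c * A i x + A i y) ->
  (forall i, exists M : R, forall v, `|A i v| <= M * `|v|) ->
  (forall c x y, B (c *: x + y) = c *: B x + B y) ->
  (forall x y (t : R), Q x -> Q y -> 0 <= t -> t <= 1 ->
    Q (t *: x + (1 - t) *: y)) ->
  0 < rho ->
  (forall y, `|y| < rho ->
     exists w q, [/\ `|w| <= 1, Q q & y = B w - (q - g)]) ->
  ~ (exists w (s : R) q, [/\ 0 < s, Q q, (forall i, A i w + a i < 0)
       & B w + b = s *: (q - g)]) ->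
  exists lam e, Lambda1 A B Q g lam e /\ 0 <= \sum_(i < m) lam i * a i + e b.
Proof.
move=> AL AM BL Qcvx rho0 rob infeas.
have A0 i : A i 0 = 0 by have := AL i 1 0 0; rewrite scale1r addr0 mul1r; lra.
have AD i x y : A i (x + y) = A i x + A i y by rewrite -[x]scale1r AL mul1r scale1r.
have AZ i c x : A i (c *: x) = c * A i x by rewrite -[_ *: _]addr0 AL A0 addr0.
have BD x y : B (x + y) = B x + B y by rewrite -[x]scale1r BL !scale1r.
have B0 : B 0 = 0 by apply: (@addrI _ (B 0)); rewrite -BD !addr0.
have BZ c x : B (c *: x) = c *: B x by rewrite -[_ *: _]addr0 BL B0 addr0.
have Qmix := convex_ray_sum g Qcvx.
pose X : lmodType R := ('rV[R]_m * E)%type.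
(* [sg] homogenizes the constants [a] and [b], and the strict inequality leaves the first component
   free upward. A representation of 0, divided by [sg], solves the excluded system. *)
pose C : set X := [set x : 'rV[R]_m * E | exists w (sg s : R) q,
  [/\ 0 < sg, 0 < s, Q q, (forall i, A i w + sg * a i < x.1 0 i)
    & x.2 = B w + sg *: b - s *: (q - g)]].
have CD x y : C x -> C y -> C (x + y).
  move=> [w [sg [s [q [sg0 s0 Qq xA xB]]]]] [v [tg [t [p [tg0 t0 Qp yA yB]]]]].
  have [r Qr rE] := Qmix _ _ _ _ s0 t0 Qq Qp.
  exists (w + v), (sg + tg), (s + t), r; split => //; rewrite ?addr_gt0//.
    move=> i; rewrite AD mulrDl addrACA mxE; exact: ltrD.
  by rewrite -rE/= xB yB BD scalerDl opprD addrACA (addrACA (B w)).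
have CZ (c : R) x : 0 < c -> C x -> C (c *: x).
  move=> c0 [w [sg [s [q [sg0 s0 Qq xA xB]]]]].
  exists (c *: w), (c * sg), (c * s), q; split => //; rewrite ?mulr_gt0//.
    by move=> i; rewrite AZ -mulrA -mulrDr mxE ltr_pM2l.
  by rewrite /= xB BZ scalerBr scalerDr !scalerA.
have C0 : ~ C 0.
  move=> [w [sg [s [q [sg0 s0 Qq xA xB]]]]]; apply: infeas.
  exists (sg^-1 *: w), (s / sg), q; split => //; first exact: divr_gt0.
    move=> i; rewrite AZ -[a i](mulKf (lt0r_neq0 sg0)) -mulrDr.
    by rewrite pmulr_rlt0 ?invr_gt0//; have := xA i; rewrite mxE.
  move/eqP: xB; rewrite eq_sym subr_eq0 => /eqP xB.
  rewrite BZ -[b](scalerK (lt0r_neq0 sg0)) -scalerDr xB scalerA.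
  by rewrite mulrC.
have [M AMM] := choice AM.
have AMn i w : `|w| <= 1 -> A i w <= `|M i|.
  move=> w1; apply: le_trans (ler_norm _) _; apply: le_trans (AMM _ _) _.
  rewrite (le_trans (ler_wpM2r _ (ler_norm _)))// -[leRHS]mulr1.
  exact: ler_wpM2l.
(* For [w] in the unit ball, each coordinate of [a0] exceeds [A i w + a i] by at least 1. This slack
   absorbs small perturbations. *)
pose a0 : X := (\row_i (a i + `|M i| + 1), b).
have core x : exists2 t : R, 0 < t & C (a0 + t *: x).
  pose D := 1 + \sum_i `|(x.1 : 'rV[R]_m) 0 i| + `|x.2|.
  have S0 : 0 <= \sum_i `|(x.1 : 'rV[R]_m) 0 i| by exact: sumr_ge0.
  have D0 : 0 < D by rewrite /D; have := normr_ge0 x.2; lra.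
  (* The bound [t * D < min 1 rho] keeps [t x.2] in the Robinson ball and each coordinate of [t x.1]
     below the slack 1. *)
  pose t := Num.min 1 rho / (2 * D).
  have mn0 : 0 < Num.min 1 rho by rewrite lt_min ltr01.
  have t0 : 0 < t by rewrite divr_gt0// mulr_gt0.
  have tD : t * D < Num.min 1 rho.
    rewrite /t invfM mulrA -mulrA mulVf ?gt_eqF// mulr1.
    by rewrite ltr_pdivrMr// mulr2n mulrDr mulr1 ltrDl.
  exists t => //.
  have [|w [q [w1 Qq xB]]] := rob (t *: x.2).
    rewrite normrZ gtr0_norm//; apply: le_lt_trans (_ : t * D < rho).
      by rewrite ler_pM2l// /D; lra.
    by apply: lt_le_trans tD _; rewrite ge_min lexx orbT.
  exists w, 1, 1, q; split => //.
    move=> i; rewrite !mxE mul1r.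
    have : `|t * (x.1 : 'rV[R]_m) 0 i| < 1.
      rewrite normrM gtr0_norm//; apply: le_lt_trans (_ : t * D < 1).
        rewrite ler_pM2l// /D (bigD1 i)//=.
        have : 0 <= \sum_(j | j != i) `|(x.1 : 'rV[R]_m) 0 j| by exact: sumr_ge0.
        have := normr_ge0 x.2; lra.
      by apply: lt_le_trans tD _; rewrite ge_min lexx.
    rewrite ltr_norml => /andP[tx _]; have := AMn i _ w1; lra.
  by rewrite /= xB !scale1r addrCA addrA.
have [phi [phiL phiC phia0]] := cone_separation CD CZ C0 core.
have phi0 : phi 0 = 0 by have := phiL 1 0 0; rewrite scale1r addr0 mul1r; lra.
have phiD x y : phi (x + y) = phi x + phi y.
  by rewrite -[x]scale1r phiL mul1r scale1r.
have phiZ c x : phi (c *: x) = c * phi x by rewrite -[_ *: _]addr0 phiL phi0 addr0.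
pose lam i := phi (delta_mx 0 i, 0).
pose e y := phi (0, y).
have phiE u y : phi (u, y) = \sum_i lam i * u 0 i + e y.
  have -> : (u, y) = (u, 0) + (0, y) :> X by congr pair; rewrite /= ?addr0 ?add0r.
  rewrite phiD; congr (_ + _).
  have psiD : {morph (fun v : 'rV[R]_m => phi (v, 0)) : v w / v + w >-> v + w}.
    by move=> v w; rewrite -phiD; congr (phi (_, _)); rewrite addr0.
  rewrite {1}[u]row_sum_delta (big_morph _ psiD phi0); apply: eq_bigr => i _.
  rewrite mulrC -phiZ; congr phi.
  by apply: injective_projections => //=; rewrite scaler0.
have eL c x y : e (c *: x + y) = c * e x + e y.
  rewrite /e -phiL; congr phi; apply: injective_projections => //=.
  by rewrite addr0; exact/esym/scaler0.
have e0 : e 0 = 0 by [].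
have eD x y : e (x + y) = e x + e y by rewrite -[x]scale1r eL mul1r scale1r.
have eZ c x : e (c *: x) = c * e x by rewrite -[_ *: _]addr0 eL e0 addr0.
have eN x : e (- x) = - e x by rewrite -scaleN1r eZ mulN1r.
have key w (sg s : R) q (u : 'I_m -> R) : 0 < sg -> 0 < s -> Q q ->
    (forall i, A i w + sg * a i < u i) ->
    0 <= \sum_i lam i * u i + (e (B w) + sg * e b - s * e (q - g)).
  move=> sg0 s0 Qq uA.
  have := phiC (\row_i u i, B w + sg *: b - s *: (q - g)).
  rewrite phiE eD eN !eZ eD eZ.
  under eq_bigr do rewrite mxE.
  by apply; exists w, sg, s, q; split => // i; rewrite mxE.
have [w0 [q0 [_ Qq0 _]]] : exists w q, [/\ `|w| <= 1, Q q & 0 = B w - (q - g)].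
  by apply: rob; rewrite normr0.
(* Raising coordinate [j] of the test vector by [n] adds [n * lam j] to the value of the
   functional. *)
have lam0 j : 0 <= lam j.
  apply: (@slope_ge0 (\sum_i lam i * (a i + 1) + (e (B 0) + 1 * e b - 1 * e (q0 - g)))).
  move=> n n0.
  have := @key 0 1 1 q0 (fun i => a i + 1 + n * (i == j)%:R) ltr01 ltr01 Qq0.
  under eq_bigr do rewrite mulrDr.
  have -> : \sum_i (lam i * (a i + 1) + lam i * (n * (i == j)%:R)) =
      \sum_i lam i * (a i + 1) + n * lam j.
    rewrite big_split/= [X in _ + X](bigD1 j)//= eqxx mulr1 [X in _ + (_ + X)]big1.
      by rewrite addr0 [lam j * n]mulrC.
    by move=> i /negPf ->; rewrite !mulr0.
  rewrite addrAC; apply => i; rewrite A0 add0r mul1r -addrA ltrDl.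
  by rewrite ltr_pwDl// mulr_ge0// ltW.
(* The test vector lies above its bound by 1 in each coordinate, which costs the constant sum of the
   [lam i]. Letting [sg], [s] or the length of [w] grow makes constants negligible and gives the
   Hessian inequality, normality and stationarity in turn. *)
have key2 w (sg s : R) q : 0 < sg -> 0 < s -> Q q ->
    0 <= (\sum_i lam i + (\sum_i lam i * A i w + e (B w)))
         + sg * (\sum_i lam i * a i + e b) - s * e (q - g).
  move=> sg0 s0 Qq.
  have := @key w sg s q (fun i => A i w + sg * a i + 1) sg0 s0 Qq.
  under eq_bigr do rewrite !mulrDr mulr1.
  rewrite !big_split/=.
  have -> : \sum_i lam i * (sg * a i) = sg * \sum_i lam i * a i.
    by rewrite mulr_sumr; apply: eq_bigr => i _; rewrite mulrCA.
  move=> H; have : forall i, A i w + sg * a i < A i w + sg * a i + 1.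
    by move=> i; rewrite ltrDl.
  by move=> /H; lra.
have hess0 : 0 <= \sum_i lam i * a i + e b.
  apply: (@slope_ge0 (\sum_i lam i + (\sum_i lam i * A i 0 + e (B 0)) - 1 * e (q0 - g))).
  move=> n n0; have := @key2 0 n 1 q0 n0 ltr01 Qq0; lra.
have norm0 q : Q q -> e (q - g) <= 0.
  move=> Qq; rewrite -oppr_ge0.
  apply: (@slope_ge0 (\sum_i lam i + (\sum_i lam i * A i 0 + e (B 0))
                      + 1 * (\sum_i lam i * a i + e b))).
  move=> n n0; have := @key2 0 1 n q ltr01 n0 Qq; lra.
have sumAZ c w : \sum_i lam i * A i (c *: w) = c * \sum_i lam i * A i w.
  by rewrite mulr_sumr; apply: eq_bigr => i _; rewrite AZ mulrCA.
have stat_ge0 w : 0 <= \sum_i lam i * A i w + e (B w).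
  apply: (@slope_ge0 (\sum_i lam i + 1 * (\sum_i lam i * a i + e b) - 1 * e (q0 - g))).
  move=> n n0; have := @key2 (n *: w) 1 1 q0 ltr01 ltr01 Qq0.
  rewrite BZ eZ sumAZ; lra.
have stat w : \sum_i lam i * A i w + e (B w) = 0.
  apply/eqP; rewrite eq_le stat_ge0 andbT -oppr_ge0.
  have := stat_ge0 (-1 *: w); rewrite BZ eZ sumAZ; lra.
(* For [y = B w - (q - g)], stationarity turns [e (B w)] into minus the sum of the [lam i * A i w],
   and normality makes [- e (q - g)] nonnegative. *)
have lower y : `|y| < rho -> - (\sum_i lam i * `|M i|) <= e y.
  move=> /rob[w [q [w1 Qq ->]]]; rewrite eD eN.
  have := norm0 _ Qq; have := stat w.
  have : \sum_i lam i * A i w <= \sum_i lam i * `|M i|.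
    by apply: ler_sum => i _; rewrite ler_wpM2l// AMn.
  lra.
have econt := linear_lower_bound_continuous eL rho0 lower.
pose N := Num.sqrt (\sum_i lam i ^+ 2).
(* If [lam] vanished, [lower] would give [e >= 0] on a ball, hence everywhere by scaling, hence
   [e = 0], contradicting [phi a0 = 1]. *)
have N0 : 0 < N.
  rewrite sqrtr_gt0 lt_def sumr_ge0 ?andbT; last by move=> i _; exact: sqr_ge0.
  apply/negP => /eqP /psumr_eq0P lam2.
  have lamz i : lam i = 0.
    by apply/eqP; rewrite -sqrf_eq0; apply/eqP/lam2 => // j _; exact: sqr_ge0.
  have ez y : 0 <= e y.
    have n0 : 0 < rho / 2 / (`|y| + 1) by rewrite !divr_gt0// ltr_wpDl.
    rewrite -(pmulr_rge0 _ n0) -eZ; apply: le_trans (lower _ _).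
      by rewrite big1 ?oppr0// => i _; rewrite lamz mul0r.
    rewrite normrZ gtr0_norm// mulrAC ltr_pdivrMr ?ltr_wpDl//.
    rewrite ltr_pM// ?ltW// ?divr_gt0//; last by rewrite ltrDl.
    by rewrite ltr_pdivrMr// mulr2n mulrDr mulr1 ltrDl.
  have : phi a0 = 0.
    rewrite phiE big1 ?add0r; last by move=> i _; rewrite lamz mul0r.
    by apply/eqP; rewrite eq_le ez andbT -oppr_ge0 -eN ez.
  by rewrite phia0; apply/eqP; rewrite oner_eq0.
exists (fun i => N^-1 * lam i), (fun y => N^-1 * e y); split; last first.
  under eq_bigr do rewrite -mulrA.
  by rewrite -mulr_sumr -mulrDr mulr_ge0// invr_ge0 ltW.
split; first by move=> i; rewrite mulr_ge0// invr_ge0 ltW.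
split.
  move=> v; under eq_bigr do rewrite -mulrA.
  by rewrite -mulr_sumr -mulrDr stat mulr0.
split.
  under eq_bigr do rewrite exprMn.
  rewrite -mulr_sumr sqrtrM ?sqr_ge0// sqrtr_sqr gtr0_norm ?invr_gt0//.
  by rewrite mulVf// gt_eqF.
split; last by move=> q Qq; rewrite mulr_ge0_le0 ?norm0// invr_ge0 ltW.
split; first by move=> c x y; rewrite eL mulrDr mulrCA.
move=> x; apply: cvgM; [exact: cvg_cst|exact: econt].
Qed.
End MultiplierRule.

(** * First- and second-order expansions of [C^2] maps *)

Section SecondOrderCalculus.
Variables (R : realType) (Z E : normedModType R).
Variables (F : Z -> E) (DF : Z -> Z -> E) (D2F : Z -> Z -> Z -> E).

(** A continuation argument: for [e > 0], the set of [t] where the bound with slope [K + e] holds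
    contains its supremum, and the local growth estimate moves past any supremum below 1. *)
Lemma mean_value_inequality (g g' : R -> E) (K : R) :
  (forall t : R, 0 <= t <= 1 -> forall e : R, 0 < e ->
    \forall s \near t, `|g s - g t - (s - t) *: g' t| <= e * `|s - t|) ->
  (forall t : R, 0 <= t <= 1 -> `|g' t| <= K) ->
  `|g 1 - g 0| <= K.
Proof.
move=> dg g'K; apply/ler_addgt0Pr => e e0.
have loc t : 0 <= t <= 1 -> exists2 r : R, 0 < r &
    forall s, `|s - t| < r -> `|g s - g t| <= (K + e) * `|s - t|.
  move=> t01; have /nbhs_normP[r /= r0 rP] := dg t t01 e e0.
  exists r => // s st; have /= := rP s; rewrite /ball_ /= distrC => /(_ st) H.
  rewrite -[g s - g t](subrK ((s - t) *: g' t)) (le_trans (ler_normD _ _))//.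
  rewrite mulrDl addrC lerD// normrZ mulrC ler_wpM2r// g'K//.
pose S : set R := [set t | 0 <= t <= 1 /\ `|g t - g 0| <= (K + e) * t].
have S0 : S 0 by rewrite /S/= lexx ler01 subrr normr0 mulr0.
have Sub : has_ubound S by exists 1 => t [/andP[]].
have supS : has_sup S by split => //; exists 0.
set c := sup S.
have c01 : 0 <= c <= 1.
  by rewrite ub_le_sup//= ge_sup//; [exists 0|move=> t [/andP[]]].
have [r r0 rP] := loc _ c01.
have Sc : S c.
  split=> //; have [s Ss cs] := sup_adherent r0 supS.
  have sc : s <= c by exact: ub_le_sup.
  have := rP s; rewrite distrC ger0_norm ?subr_ge0// ltrBlDr -ltrBlDl => /(_ cs).
  rewrite distrC => H; case: Ss => _ gs.
  have -> : g c - g 0 = (g c - g s) + (g s - g 0) by rewrite addrA subrK.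
  by rewrite (le_trans (ler_normD _ _))//; lra.
have [c1|c1] := eqVneq c 1; first by case: Sc => _; rewrite c1 mulr1.
have {}c1 : c < 1 by rewrite lt_neqAle c1; case/andP: c01.
pose s := c + Num.min (r / 2) (1 - c).
have m0 : 0 < Num.min (r / 2) (1 - c) by rewrite lt_min divr_gt0//= subr_gt0.
have cs : c < s by rewrite ltrDl.
have Ss : S s.
  split.
    rewrite (le_trans _ (ltW cs))/=; last by case/andP: c01.
    by rewrite -lerBrDl ge_min lexx orbT.
  have := rP s; rewrite /s addrAC subrr add0r gtr0_norm//.
  have -> : Num.min (r / 2) (1 - c) < r.
    by rewrite gt_min ltr_pdivrMr// mulr2n mulrDr mulr1 ltrDl r0.
  move=> /(_ isT) H; have [_ gc] := Sc.
  have -> : g s - g 0 = (g s - g c) + (g c - g 0) by rewrite addrA subrK.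
  by rewrite (le_trans (ler_normD _ _))// mulrDr addrC lerD.
by have := ub_le_sup Sub Ss; rewrite leNgt cs.
Qed.

Lemma differentiable_expansion (x : Z) (e : R) : differentiable F x -> 0 < e ->
  \forall h \near (0 : Z), `|F (x + h) - F x - 'd F x h| <= e * `|h|.
Proof.
move=> /diff_locally/eqaddoP Fx /Fx; apply: filterS => h.
by rewrite opprD addrA; congr (is_true (`|F _ - _ - _| <= _)); exact: addrC.
Qed.

Hypothesis F2 : C2_with F DF D2F.

Lemma C2_linear z a u v : DF z (a *: u + v) = a *: DF z u + DF z v.
Proof. by have [_ dF] := F2.1 z; rewrite -!dF linearP. Qed.

Lemma C2_bounded z : exists M : R, forall v, `|DF z v| <= M * `|v|.
Proof.
have [Fz dF] := F2.1 z.
have /linear_boundedP : bounded_near ('d F z) (nbhs (0 : Z)).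
  by apply: continuous_linear_bounded; exact: diff_continuous.
move=> /pinfty_ex_gt0[M M0 FM]; exists M => v; by rewrite -dF.
Qed.

(** The mean value inequality is applied to [F (z + t h) - t A - t^2 B / 2]. Taking [B = 0] serves
    strict differentiability, and [B = D2F z h h] the Taylor expansion. *)
Lemma C2_segment z h A B (K : R) :
  (forall t, 0 <= t <= 1 -> `|DF (z + t *: h) h - A - t *: B| <= K) ->
  `|F (z + h) - F z - A - 2^-1 *: B| <= K.
Proof.
move=> DFK.
have := @mean_value_inequality (fun t => F (z + t *: h) - t *: A - (t ^+ 2 / 2) *: B)
  (fun t => DF (z + t *: h) h - A - t *: B) K _ DFK.
rewrite !scale1r !scale0r expr1n expr0n /= mul0r mul1r scale0r !subr0 addr0.
have -> : F (z + h) - A - 2^-1 *: B - F z = F (z + h) - F z - A - 2^-1 *: B.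
  by rewrite addrAC; congr (_ - _); rewrite addrAC.
apply=> t t01 e e0.
have [Ft dF] := F2.1 (z + t *: h).
(* Half of [e] pays for the first-order remainder of [F], the other half for [(s - t)^2 B / 2]. *)
have e1 : 0 < e / 2 / (`|h| + 1) by rewrite !divr_gt0// ltr_wpDl.
have := differentiable_expansion Ft e1.
move=> /nbhs_norm0P[r /= r0 rP].
near=> s.
have : `|F (z + s *: h) - F (z + t *: h) - (s - t) *: DF (z + t *: h) h|
    <= e / 2 * `|s - t|.
  have := rP ((s - t) *: h).
  have dFst : 'd F (z + t *: h) ((s - t) *: h) = (s - t) *: DF (z + t *: h) h.
    by rewrite linearZ/= dF.
  have zst : z + t *: h + (s - t) *: h = z + s *: h.
    by rewrite -addrA -scalerDl [t + _]addrC subrK.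
  rewrite dFst zst => H.
  apply: le_trans (H _) _.
    rewrite /= normrZ.
    apply: (@le_lt_trans _ _ (`|s - t| * (`|h| + 1))); first by rewrite ler_wpM2l// lerDl.
    rewrite -ltr_pdivlMr ?ltr_wpDl//.
    rewrite distrC; near: s; apply: cvgr_dist_lt; first exact: cvg_id.
    by rewrite divr_gt0// ltr_wpDl.
  rewrite normrZ [leLHS]mulrCA [leRHS]mulrC ler_wpM2l//.
  by rewrite mulrAC ler_pdivrMr ?ltr_wpDl// ler_wpM2l ?lerDl// divr_ge0// ltW.
move=> H1.
have H2 : `|((s - t) ^+ 2 / 2) *: B| <= e / 2 * `|s - t|.
  rewrite normrZ normrM normrX (ger0_norm (_ : 0 <= 2^-1)) ?invr_ge0//.
  have sB : `|s - t| * `|B| <= e.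
    apply: (@le_trans _ _ (`|s - t| * (`|B| + 1))); first by rewrite ler_wpM2l// lerDl.
    rewrite -ler_pdivlMr ?ltr_wpDl//.
    rewrite distrC; near: s; apply: cvgr_dist_le; first exact: cvg_id.
    by rewrite divr_gt0// ltr_wpDl.
  by have := ler_wpM2r (normr_ge0 (s - t)) sB; lra.
have subACA (x y u v : E) : (x - y) - (u - v) = (x - u) - (y - v).
  by rewrite opprD addrACA -opprD.
rewrite subACA [F (z + s *: h) - _ - _]subACA -2!scalerBl 2!(scalerBr (s - t)) subACA.
rewrite [F (z + s *: h) - _ - _ - _]subACA subrr subr0 scalerA -scalerBl.
have -> : s ^+ 2 / 2 - t ^+ 2 / 2 - (s - t) * t = (s - t) ^+ 2 / 2 by field.
rewrite (le_trans (ler_normB _ _))// (le_trans (lerD H1 H2))//.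
by rewrite -mulrDl -splitr.
Unshelve. all: by end_near. Qed.

(** Differentiability of [DF] at [z] with tolerance 1 bounds its variation by [1 + |M|] times the
    distance to [z]. This bound holds along the segment from [x] to [y], which stays in the ball. *)
Lemma C2_strict_differentiable z (eta : R) : 0 < eta -> exists2 delta : R, 0 < delta &
  forall x y, `|x - z| < delta -> `|y - z| < delta ->
    `|F y - F x - DF z (y - x)| <= eta * `|y - x|.
Proof.
move=> eta0; have [_ [_ [_ [D2M [dDF _]]]]] := F2.
have [M MP] := D2M z; have [r r0 rP] := dDF z 1 ltr01.
have K0 : 0 < 1 + `|M| by rewrite ltr_wpDr.
exists (Num.min r (eta / (1 + `|M|))); first by rewrite lt_min r0 divr_gt0.
move=> x y; set dl := Num.min _ _ => xz yz.
have := @C2_segment x (y - x) (DF z (y - x)) 0 (eta * `|y - x|).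
rewrite addrCA subrr addr0 scaler0 subr0; apply => t /andP[t0 t1].
rewrite scaler0 subr0.
set h := x + t *: (y - x) - z.
have hdl : `|h| < dl.
  have -> : h = (1 - t) *: (x - z) + t *: (y - z).
    rewrite scalerBl scale1r -addrA [- _ + _]addrC -scalerBr opprB [_ + (z - x)]addrA.
    by rewrite subrK addrAC.
  apply: le_lt_trans (ler_normD _ _) _; rewrite !normrZ !ger0_norm ?subr_ge0//.
  have [->|] := eqVneq t 0; first by rewrite subr0 mul1r mul0r addr0.
  move=> tn0; have tp : 0 < t by rewrite lt_def tn0.
  have -> : dl = (1 - t) * dl + t * dl by ring.
  by rewrite ler_ltD// ?ltr_pM2l// ler_wpM2l ?subr_ge0// ltW.
have hr : `|h| < r by apply: lt_le_trans hdl _; rewrite ge_min lexx.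
have he : `|h| <= eta / (1 + `|M|).
  by apply: ltW; apply: lt_le_trans hdl _; rewrite ge_min lexx orbT.
have := rP _ hr (y - x); rewrite /h [z + _]addrC subrK mul1r -/h => H.
rewrite -[X in `|X|](subrK (D2F z h (y - x))) (le_trans (ler_normD _ _))//.
apply: (@le_trans _ _ (`|h| * `|y - x| + `|M| * `|h| * `|y - x|)).
  rewrite lerD// (le_trans (MP _ _))// !ler_wpM2r// ler_norm//.
rewrite -mulrDl ler_wpM2r// -{1}[`|h|]mul1r -mulrDl mulrC.
by rewrite -ler_pdivlMr.
Qed.

(** On the segment, differentiability of [DF] at [z] bounds [DF (z + t h) h - DF z h - t D2F z h h]
    by [eta |h|^2]. *)
Lemma C2_taylor z (eta : R) : 0 < eta -> exists2 delta : R, 0 < delta &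
  forall h, `|h| < delta ->
    `|F (z + h) - F z - DF z h - 2^-1 *: D2F z h h| <= eta * `|h| ^+ 2.
Proof.
move=> eta0; have [_ [D2l [_ [_ [dDF _]]]]] := F2.
have [r r0 rP] := dDF z eta eta0; exists r => // h hr.
apply: C2_segment => t /andP[t0 t1].
have D20 v : D2F z 0 v = 0.
  by apply: (@addrI _ (D2F z 0 v)); rewrite -{1}[D2F z 0 v]scale1r -D2l scaler0 !addr0.
have -> : t *: D2F z h h = D2F z (t *: h) h.
  by rewrite -[t *: h]addr0 D2l D20 addr0.
have thh : `|t *: h| <= `|h| by rewrite normrZ ger0_norm// ler_piMl.
have := rP _ (le_lt_trans thh hr) h => /le_trans; apply.
by rewrite expr2 mulrA ler_wpM2r// ler_wpM2l// ltW.
Qed.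

Lemma C2_hessian_continuous z : continuous (fun u => D2F z u u).
Proof.
have [_ [D2l [D2r [D2M _]]]] := F2.
have [M MP] := D2M z => u; apply/cvgrPdist_le => e e0.
have C0 : 0 < `|M| * (`|u| + (`|u| + 1)) + 1 by rewrite ltr_wpDl// mulr_ge0// !addr_ge0.
near=> v.
have uv : `|u - v| <= e / (`|M| * (`|u| + (`|u| + 1)) + 1).
  by near: v; apply: cvgr_dist_le; [exact: cvg_id|rewrite divr_gt0].
have v1 : `|v| <= `|u| + 1.
  have : `|u - v| <= 1 by near: v; apply: cvgr_dist_le; [exact: cvg_id|].
  by have := ler_distD u v 0; rewrite !subr0 distrC; lra.
have -> : D2F z u u - D2F z v v = D2F z (u - v) u + D2F z v (u - v).
  have -> : D2F z u u = D2F z (u - v) u + D2F z v u.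
    by rewrite -[D2F z (u - v) u]scale1r -D2l scale1r subrK.
  have -> : D2F z v u = D2F z v (u - v) + D2F z v v.
    by rewrite -[D2F z v (u - v)]scale1r -D2r scale1r subrK.
  by rewrite addrA addrK.
rewrite (le_trans (ler_normD _ _))//.
apply: (@le_trans _ _ ((`|M| * (`|u| + (`|u| + 1)) + 1) * `|u - v|)); last first.
  by rewrite mulrC -ler_pdivlMr.
have H1 : `|D2F z (u - v) u| <= `|M| * `|u - v| * `|u|.
  by rewrite (le_trans (MP _ _))// !ler_wpM2r// ler_norm.
have H2 : `|D2F z v (u - v)| <= `|M| * (`|u| + 1) * `|u - v|.
  rewrite (le_trans (MP _ _))// ler_wpM2r//.
  by rewrite (le_trans (ler_wpM2r _ (ler_norm M)))// ler_wpM2l.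
apply: le_trans (lerD H1 H2) _; rewrite mulrDl mul1r.
by have := normr_ge0 (u - v); lra.
Unshelve. all: by end_near. Qed.

Lemma parabola_direction_cvg (d w : Z) : d + t *: w @[t --> (0 : R)^'+] --> d.
Proof.
rewrite -[X in _ --> X]addr0; apply: cvgD; first exact: cvg_cst.
rewrite -[X in _ --> X](scale0r w); apply: cvgZ; last exact: cvg_cst.
exact/cvg_at_right_filter/cvg_id.
Qed.

Lemma parabola_cvg (d w : Z) :
  t *: (d + t *: w) @[t --> (0 : R)^'+] --> (0 : Z).
Proof.
rewrite -[X in _ --> X](scale0r d); apply: cvgZ; last exact: parabola_direction_cvg.
exact/cvg_at_right_filter/cvg_id.
Qed.

(** In the Taylor expansion at [h = t (d + t w)], the linear term contributes
    [t DF z d + t^2 DF z w], and replacing [d + t w] by [d] in the Hessian term costs [o(t^2)]. *)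
Lemma C2_parabola z d w (e : R) : 0 < e -> \forall t \near (0 : R)^'+,
  `|F (z + t *: (d + t *: w)) - F z - t *: DF z d
     - t ^+ 2 *: (DF z w + 2^-1 *: D2F z d d)| <= e * t ^+ 2.
Proof.
move=> e0; have [_ [D2l [D2r _]]] := F2.
(* [N] dominates [|d + t w|^2] for [0 < t <= 1], so the tolerance [e / 2 / N] in the Taylor bound
   costs at most [e / 2 * t^2]. *)
pose N := (`|d| + `|w|) ^+ 2 + 1.
have N0 : 0 < N by rewrite ltr_wpDl// sqr_ge0.
have e20 : 0 < e / 2 by rewrite divr_gt0.
have [r r0 rP] := C2_taylor z (divr_gt0 e20 N0).
have dwt := @parabola_direction_cvg d w.
have hess : (fun t : R => D2F z (d + t *: w) (d + t *: w)) @ (0 : R)^'+ --> D2F z d d.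
  apply: (@continuous_cvg _ _ _ _ _ _ (fun u => D2F z u u) d _ dwt).
  exact: C2_hessian_continuous.
have ht := @parabola_cvg d w.
near=> t.
have t0 : 0 < t by near: t; exact: nbhs_right_gt.
have t1 : t <= 1 by near: t; exact: nbhs_right_le.
have hr : `|t *: (d + t *: w)| < r by near: t; apply: (cvgr0_norm_lt _ ht).
have H1 : `|D2F z d d - D2F z (d + t *: w) (d + t *: w)| <= e.
  by near: t; apply: (cvgr_dist_le _ _ hess).
set h := t *: (d + t *: w) in hr *.
have := rP _ hr.
have D0 : DF z 0 = 0.
  by apply: (@addrI _ (DF z 0)); rewrite -{1}[DF z 0]scale1r -C2_linear scaler0 !addr0.
have -> : DF z h = t *: DF z d + t ^+ 2 *: DF z w.
  rewrite /h scalerDr scalerA -expr2 C2_linear.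
  by rewrite -[_ *: w]addr0 C2_linear D0 addr0.
have -> : D2F z h h = t ^+ 2 *: D2F z (d + t *: w) (d + t *: w).
  set u := d + _.
  have D20 v : D2F z 0 v = 0.
    by apply: (@addrI _ (D2F z 0 v)); rewrite -{1}[D2F z 0 v]scale1r -D2l scaler0 !addr0.
  have D2r0 v : D2F z v 0 = 0.
    by apply: (@addrI _ (D2F z v 0)); rewrite -{1}[D2F z v 0]scale1r -D2r scaler0 !addr0.
  have D2Zl a v v' : D2F z (a *: v) v' = a *: D2F z v v'.
    by rewrite -[a *: v]addr0 D2l D20 addr0.
  have D2Zr a v v' : D2F z v (a *: v') = a *: D2F z v v'.
    by rewrite -[a *: v']addr0 D2r D2r0 addr0.
  by rewrite /h -/u D2Zl D2Zr scalerA expr2.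
set P := F (z + h) - F z; set D1 := t *: DF z d; set u := d + t *: w.
move=> H2.
have -> : P - D1 - t ^+ 2 *: (DF z w + 2^-1 *: D2F z d d) =
   (P - (D1 + t ^+ 2 *: DF z w) - 2^-1 *: (t ^+ 2 *: D2F z u u))
   - (t ^+ 2 * 2^-1) *: (D2F z d d - D2F z u u).
  rewrite scalerBr scalerDr !scalerA [2^-1 * _]mulrC opprB [RHS]addrA subrK.
  by rewrite !opprD !addrA.
apply: le_trans (ler_normB _ _) _.
have hN : `|h| ^+ 2 <= N * t ^+ 2.
  rewrite /h normrZ exprMn (gtr0_norm t0) mulrC ler_wpM2r ?sqr_ge0//.
  rewrite /N ler_wpDr// lerXn2r ?nnegrE ?addr_ge0//.
  rewrite (le_trans (ler_normD _ _))// lerD// normrZ (gtr0_norm t0).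
  by rewrite ler_piMl.
have H3 : e / 2 / N * `|h| ^+ 2 <= e / 2 * t ^+ 2.
  by rewrite mulrAC ler_pdivrMr// -[leRHS]mulrA (ler_wpM2l (ltW e20))// mulrC.
have H4 : `|t ^+ 2 * 2^-1 *: (D2F z d d - D2F z u u)| <= e / 2 * t ^+ 2.
  rewrite normrZ ger0_norm ?mulr_ge0 ?sqr_ge0//.
  have := ler_wpM2l (sqr_ge0 t) H1; lra.
by have := le_trans H2 H3; lra.
Unshelve. all: by end_near. Qed.

End SecondOrderCalculus.

(** * Restoration of feasibility under Robinson's condition *)

Section Restoration.
Variables (R : realType) (Z : completeNormedModType R) (E : normedModType R).

Lemma geometric_steps_cvg (x : Z^nat) (C : R) :
  (forall n, `|x n.+1 - x n| <= C * 2^-1 ^+ n) -> cvgn x.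
Proof.
move=> xC.
have C0 : 0 <= C by have := xC 0; rewrite expr0 mulr1; apply: le_trans.
have : cvgn (series (telescope x)).
  apply: normed_cvg; apply: (@series_le_cvg _ _ (geometric C 2^-1)).
  - by move=> n; exact: normr_ge0.
  - by move=> n; rewrite /geometric/= mulr_ge0.
  - exact: xC.
  - by apply: is_cvg_geometric_series; rewrite ger0_norm ?invr_ge0// invf_lt1// ltr1n.
rewrite telescopeK => /cvg_ex[l xl]; apply/cvg_ex; exists (l + x 0).
have xE : (fun n => x n - x 0) + cst (x 0) = x.
  by apply/funext => n; rewrite fctE subrK.
by have := cvgD xl (@cvg_cst _ (x 0) nat \oo _); rewrite xE; exact.
Qed.

Variables (G L : Z -> E) (Q : set E) (zb : Z) (rho : R).
Hypothesis G_cont : continuous G.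
Hypothesis G_strict : forall eta : R, 0 < eta -> exists2 delta : R, 0 < delta &
  forall x y, `|x - zb| < delta -> `|y - zb| < delta ->
    `|G y - G x - L (y - x)| <= eta * `|y - x|.
Hypothesis L_scale : forall (a : R) v, L (a *: v) = a *: L v.
Hypothesis L_bounded : exists M : R, forall v, `|L v| <= M * `|v|.
Hypothesis Q_closed : closed Q.
Hypothesis Q_convex : forall x y (t : R), Q x -> Q y -> 0 <= t -> t <= 1 ->
  Q (t *: x + (1 - t) *: y).
Hypothesis rho0 : 0 < rho.
Hypothesis rob : forall y, `|y| < rho ->
  exists w q, [/\ `|w| <= 1, Q q & y = L w - (q - G zb)].

(* Linearizing [G] and moving both [x] and its target [q] along a Robinson
   direction of length proportional to the residual [G x - q] leaves only the
   linearization error and [t (q - G zb)], each small relative to the residual. *)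
Lemma restoration_step : exists2 beta : R, 0 < beta &
  forall x q, Q q -> `|x - zb| + 2 / rho * `|G x - q| < beta ->
    exists x' q', [/\ Q q', `|x' - x| <= 2 / rho * `|G x - q|
      & `|G x' - q'| <= 2^-1 * `|G x - q|].
Proof.
(* With [tau = 2 / rho * r] below, [eta * tau] is [r / 4]. The new residual is a sum of two terms
   bounded by it, hence at most [r / 2]. *)
pose eta := rho / 8.
have eta0 : 0 < eta by rewrite divr_gt0.
have [delta delta0 Gd] := G_strict eta0.
have [M0 M0P] := L_bounded.
pose M := `|M0|.
have M_ge0 : 0 <= M by exact: normr_ge0.
have MP v : `|L v| <= M * `|v|.
  by rewrite (le_trans (M0P v))// ler_wpM2r// ler_norm.
have rho2 : 0 < 2 / rho by rewrite divr_gt0.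
pose K := M + eta + rho / 2.
have K0 : 0 < K.
  by apply: addr_gt0; [exact: ltr_wpDl|exact: divr_gt0].
(* The three bounds keep the points where [G_strict] applies, make [tau] a convex weight, and force
   [|q - G zb| <= eta]. *)
exists (Num.min delta (Num.min 1 (eta / K))).
  by rewrite !lt_min delta0 ltr01 divr_gt0.
set beta := Num.min _ _ => x q Qq; set r := `|G x - q| => xb.
have b_delta : beta <= delta by rewrite ge_min lexx.
have b_1 : beta <= 1 by rewrite !ge_min lexx orbT.
have b_eta : beta <= eta / K by rewrite !ge_min lexx !orbT.
have r0 : 0 <= r by exact: normr_ge0.
have tau0 : 0 <= 2 / rho * r by rewrite mulr_ge0// ltW.
set tau := 2 / rho * r in tau0 xb *.
have rtau : r = rho / 2 * tau by rewrite /tau; field; rewrite gt_eqF.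
have xz : 0 <= `|x - zb| by [].
have qg : `|q - G zb| <= eta.
  have -> : q - G zb = (G x - G zb - L (x - zb)) + L (x - zb) - (G x - q).
    by rewrite subrK opprB [RHS]addrC addrA subrK.
  apply: le_trans (ler_normB _ _) _; rewrite -/r.
  have H1 := ler_normD (G x - G zb - L (x - zb)) (L (x - zb)).
  have H2 : `|G x - G zb - L (x - zb)| <= eta * `|x - zb|.
    by apply: Gd; rewrite ?subrr ?normr0//; lra.
  have H3 := MP (x - zb).
  have H4 : K * (`|x - zb| + tau) <= eta.
    by rewrite mulrC -ler_pdivlMr// (le_trans (ltW xb)).
  have H5 : 0 <= (M + eta) * tau by rewrite mulr_ge0// addr_ge0// ltW.
  have H6 : 0 <= rho / 2 * `|x - zb| by rewrite mulr_ge0// divr_ge0// ltW.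
  move: H4; rewrite rtau /K; lra.
have tau1 : tau <= 1 by lra.
(* The Robinson target is opposite to the residual and, when that is nonzero, has length [rho / 2];
   [tau] times the target then cancels [G x - q]. *)
have [] := rob (y := - ((rho / 2 / r) *: (G x - q))).
  rewrite normrN normrZ normrM normfV (ger0_norm r0) -/r gtr0_norm ?divr_gt0//.
  have [->|rn0] := eqVneq r 0; first by rewrite mulr0.
  by rewrite divfK// ltr_pdivrMr// mulr2n mulrDr mulr1 ltrDl.
move=> w [p [w1 Qp wpE]].
have resE : G x - q = - (tau *: (L w - (p - G zb))).
  rewrite -wpE scalerN opprK scalerA.
  have [r_eq0|rn0] := eqVneq r 0.
    have /eqP : G x - q == 0 by rewrite -normr_eq0 -/r r_eq0.
    by move=> ->; rewrite scaler0.
  rewrite (_ : tau * _ = 1) ?scale1r// /tau; field.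
  by rewrite rn0 gt_eqF.
exists (x + tau *: w), (tau *: p + (1 - tau) *: q); split.
- exact: Q_convex.
- by rewrite [x + _]addrC addrK normrZ ger0_norm// ler_piMr.
have tw : `|tau *: w| <= tau by rewrite normrZ ger0_norm// ler_piMr.
set err := G (x + tau *: w) - G x - L (tau *: w).
have errP : `|err| <= eta * tau.
  have := Gd x (x + tau *: w).
  have -> : x + tau *: w - x = tau *: w by rewrite [x + _]addrC addrK.
  move=> H; apply: le_trans (H _ _) _; last by rewrite ler_wpM2l// ltW.
    lra.
  rewrite addrAC; have := ler_normD (x - zb) (tau *: w); lra.
have -> : G (x + tau *: w) - (tau *: p + (1 - tau) *: q) = err + tau *: (q - G zb).
  have -> : G (x + tau *: w) = err + (G x - q) + tau *: L w + q.
    rewrite /err L_scale [RHS]addrAC -[_ - _ + (G x - q) + q]addrA subrK.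
    by rewrite [_ - _ + G x]addrAC !subrK.
  have cancel_residual (a b c u v : E) :
      - (a - (b - c)) + (a + (u - (b + (u - v)))) = v - c.
    rewrite opprB addrA subrK opprD opprB [u + _]addrCA [u + _]addrC subrK.
    by rewrite [b - _ + _]addrC addrACA addNr add0r.
  clearbody err; rewrite resE !scalerBr scalerBl scale1r -!addrA; congr (err + _).
  exact: cancel_residual.
apply: le_trans (ler_normD _ _) _; rewrite normrZ (ger0_norm tau0).
have := ler_wpM2l tau0 qg; move: errP rtau; rewrite -/r /eta; lra.
Qed.

(** Residuals halve at each step, so the steps have total length at most [4 / rho] times the initial
    residual and the iterates converge by completeness. Closedness of [Q] makes the limit
    feasible. *)
Lemma robinson_restoration : exists c delta : R, [/\ 0 < c, 0 < delta &
  forall x0 q0, Q q0 -> `|x0 - zb| < delta -> `|G x0 - q0| < delta ->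
    exists2 x, Q (G x) & `|x - x0| <= c * `|G x0 - q0|].
Proof.
have [beta beta0 step] := restoration_step.
have rho4 : 0 < 4 / rho by rewrite divr_gt0.
exists (4 / rho), (beta / (1 + 4 / rho)); split => //.
  by rewrite divr_gt0// addr_gt0.
move=> x0 q0 Qq0 x0z; set r0 := `|G x0 - q0| => r0d.
have r0_ge0 : 0 <= r0 by exact: normr_ge0.
have small : `|x0 - zb| + 4 / rho * r0 < beta.
  have d1 : beta / (1 + 4 / rho) * (1 + 4 / rho) = beta.
    by rewrite divfK// gt_eqF// addr_gt0.
  have := ltr_pM2l rho4 r0 (beta / (1 + 4 / rho)); rewrite r0d => H.
  by rewrite -d1 mulrDr mulr1 ltrD// mulrC ltr_pM2r.
pose res (p : Z * E) := `|G p.1 - p.2|.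
have [T TP] : exists T : Z * E -> Z * E, forall p, Q p.2 ->
    `|p.1 - zb| + 2 / rho * res p < beta ->
    [/\ Q (T p).2, `|(T p).1 - p.1| <= 2 / rho * res p & res (T p) <= 2^-1 * res p].
  have /choice[T TP] : forall p : Z * E, exists p' : Z * E, Q p.2 ->
      `|p.1 - zb| + 2 / rho * res p < beta ->
      [/\ Q p'.2, `|p'.1 - p.1| <= 2 / rho * res p & res p' <= 2^-1 * res p].
    move=> [x q]; have [[Qq xb]|nQ] := pselect (Q q /\
        `|x - zb| + 2 / rho * res (x, q) < beta).
      by have [x' [q' ?]] := step _ _ Qq xb; exists (x', q').
    by exists (x, q) => /= ? ?; exfalso; apply: nQ.
  by exists T.
pose s n := iter n T (x0, q0).
pose h n : R := 2^-1 ^+ n.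
have h0 n : 0 <= h n by rewrite exprn_ge0// invr_ge0.
have hS n : h n.+1 = 2^-1 * h n by rewrite /h exprS.
(* The distance already covered plus [2 / rho] times the current residual stays within
   [4 / rho * r0], so [small] keeps the iterate in the domain. *)
have good n : `|(s n).1 - x0| <= 4 / rho * r0 * (1 - h n) -> res (s n) <= h n * r0 ->
    `|(s n).1 - zb| + 2 / rho * res (s n) < beta.
  move=> H1 H2.
  have := ler_distD x0 (s n).1 zb.
  have := ler_wpM2l (ltW rho4) H2.
  have : 0 <= 4 / rho * r0 * h n by exact: mulr_ge0 (mulr_ge0 (ltW rho4) r0_ge0) (h0 n).
  have : 0 <= 4 / rho * r0 by exact: mulr_ge0 (ltW rho4) r0_ge0.
  have -> : 2 / rho = 4 / rho / 2 by field; rewrite gt_eqF.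
  set k := 4 / rho in small H1 *.
  lra.
have inv n : [/\ Q (s n).2, `|(s n).1 - x0| <= 4 / rho * r0 * (1 - h n)
    & res (s n) <= h n * r0].
  elim: n => [|n [Qn xn rn]].
    by split => //=; rewrite /h expr0 ?subrr ?normr0 ?mulr0// mul1r.
  have [QS xS rS] := TP _ Qn (good _ xn rn).
  split; first exact: QS.
    rewrite hS; have := ler_distD (s n).1 (s n.+1).1 x0.
    move: xS; rewrite -/(s n.+1).
    have -> : 2 / rho = 4 / rho / 2 by field; rewrite gt_eqF.
    have := ler_wpM2l (ltW rho4) rn.
    set k := 4 / rho in xn *; lra.
  by rewrite hS -mulrA (le_trans rS)// ler_wpM2l// invr_ge0.
have incr n : `|(s n.+1).1 - (s n).1| <= 2 / rho * r0 * 2^-1 ^+ n.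
  have [Qn xn rn] := inv n; have [_ xS _] := TP _ Qn (good _ xn rn).
  have rho2 : 0 <= 2 / rho by rewrite divr_ge0// ltW.
  by rewrite (le_trans xS)// -[leRHS]mulrA (ler_wpM2l rho2)// mulrC.
have /cvg_ex[x xP] := geometric_steps_cvg incr.
exists x.
  have Gx : G (s n).1 @[n --> \oo] --> G x.
    by apply: (@continuous_cvg _ _ _ _ _ _ G x _ xP); exact: G_cont.
  have hcvg : h n * r0 @[n --> \oo] --> (0 : R).
    have /cvg_geometric hr : `|2^-1 : R| < 1.
      by rewrite ger0_norm ?invr_ge0// invf_lt1// ltr1n.
    by have := hr r0; under eq_fun do rewrite /geometric/= mulrC.
  (* [G (s n).1] tends to [G x] and the residual to 0, so the targets [(s n).2], all in [Q], also
     tend to [G x]. *)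
  apply: (@closed_cvg nat E \oo _ (fun n => (s n).2) Q Q_closed).
    by apply: nearW => n; have [] := inv n.
  apply/cvgrPdist_le => e e0; near=> n.
  have [_ _ rn] := inv n.
  have H1 : `|G x - G (s n).1| <= e / 2.
    by near: n; apply: (cvgr_dist_le _ _ Gx); rewrite divr_gt0.
  have H2 : h n * r0 <= e / 2.
    rewrite (le_trans (ler_norm _))//.
    by near: n; apply: (cvgr0_norm_le _ hcvg); rewrite divr_gt0.
  have := ler_distD (G (s n).1) (G x) (s n).2; rewrite /res in rn; lra.
apply/ler_addgt0Pr => e e0; near \oo => n.
have [_ xn _] := inv n.
have H1 : `|x - (s n).1| <= e by near: n; exact: (cvgr_dist_le _ _ xP).
have := ler_distD (s n).1 x x0.
have : 0 <= 4 / rho * r0 * h n by exact: mulr_ge0 (mulr_ge0 (ltW rho4) r0_ge0) (h0 n).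
lra.
Unshelve. all: by end_near. Qed.
End Restoration.

(** * The primal second-order necessary condition *)

Section NecessaryConditions.
Variable R : realType.

(** Along the parabola [f] falls by at least [3 / 4 * kappa * t^2]. A displacement of [e t^2]
    regains at most [kappa / 4 * t^2], because strict differentiability with tolerance 1 gives the
    Lipschitz constant [|M| + 1] near [z]. *)
Lemma C2_descent (Z : normedModType R) (f : Z -> R) Df D2f (z d w : Z) :
  C2_with f Df D2f -> Df z d <= 0 -> Df z w + 2^-1 * D2f z d d < 0 ->
  \forall e \near (0 : R)^'+, \forall t \near (0 : R)^'+, forall x,
    `|x - (z + t *: (d + t *: w))| <= e * t ^+ 2 -> f x < f z.
Proof.
move=> f2 dfd dfw.
pose kappa := - (Df z w + 2^-1 * D2f z d d).
have kappa0 : 0 < kappa by rewrite oppr_gt0.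
have kappa4 : 0 < kappa / 4 by rewrite divr_gt0.
have [delta delta0 fd] := C2_strict_differentiable f2 z ltr01.
have [M MP] := C2_bounded f2 z.
have K0 : 0 < `|M| + 1 by rewrite ltr_wpDl.
have := C2_parabola f2 z d w kappa4 => para.
near=> e.
have e0 : 0 < e by near: e; exact: nbhs_right_gt.
have e1 : e <= 1 by near: e; apply: nbhs_right_le.
have eK : (`|M| + 1) * e <= kappa / 4.
  rewrite mulrC -ler_pdivlMr//.
  by near: e; apply: nbhs_right_le; rewrite divr_gt0.
near=> t => x xh.
have t0 : 0 < t by near: t; exact: nbhs_right_gt.
have t20 : 0 < t ^+ 2 by rewrite exprn_gt0.
have t1 : t <= 1 by near: t; apply: nbhs_right_le.
have t4 : t <= delta / 4 by near: t; apply: nbhs_right_le; rewrite divr_gt0.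
have hd : `|t *: (d + t *: w)| <= delta / 4.
  by near: t; apply: (cvgr0_norm_le _ (@parabola_cvg R Z d w)); rewrite divr_gt0.
have parat : `|f (z + t *: (d + t *: w)) - f z - t *: Df z d
     - t ^+ 2 *: (Df z w + 2^-1 *: D2f z d d)| <= kappa / 4 * t ^+ 2.
  by near: t.
set h := t *: (d + t *: w) in xh hd parat.
have tt : t ^+ 2 <= delta / 4.
  by apply: le_trans t4; rewrite expr2 ler_piMr// ltW.
have et : e * t ^+ 2 <= t ^+ 2 by rewrite ler_piMl// ltW.
have zh : `|z + h - z| < delta.
  by rewrite [z + h]addrC addrK; lra.
have xz : `|x - z| < delta.
  have := ler_normD (x - (z + h)) h.
  have -> : x - (z + h) + h = x - z by rewrite opprD addrA subrK.
  lra.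
have xzh : f x - f (z + h) <= (`|M| + 1) * `|x - (z + h)|.
  have := fd _ _ zh xz; set v := x - (z + h).
  rewrite ler_norml => /andP[_ H1].
  have : Df z v <= `|M| * `|v|.
    rewrite (le_trans (ler_norm _))// (le_trans (MP v))//.
    by rewrite ler_wpM2r// ler_norm.
  lra.
have H1 : (`|M| + 1) * `|x - (z + h)| <= kappa / 4 * t ^+ 2.
  apply: le_trans (ler_wpM2l (ltW K0) xh) _.
  by rewrite mulrA ler_wpM2r// ltW.
have H2 : t * Df z d <= 0 by rewrite mulr_ge0_le0// ltW.
have H3 : 0 < kappa * t ^+ 2 by rewrite mulr_gt0.
move: parat; rewrite ler_norml => /andP[_].
have -> : t ^+ 2 *: (Df z w + 2^-1 *: D2f z d d) = - (kappa * t ^+ 2).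
  by rewrite /kappa mulNr opprK mulrC.
have -> : t *: Df z d = t * Df z d by [].
lra.
Unshelve. all: by end_near. Qed.

Variables (Z E : completeNormedModType R) (m : nat).
Variables (f : 'I_m -> Z -> R) (Df : 'I_m -> Z -> Z -> R).
Variables (D2f : 'I_m -> Z -> Z -> Z -> R).
Variables (G : Z -> E) (DG : Z -> Z -> E) (D2G : Z -> Z -> Z -> E).
Variables (Q : set E) (zb : Z) (rho : R).
Hypothesis f2 : forall i, C2_with (f i) (Df i) (D2f i).
Hypothesis G2 : C2_with G DG D2G.
Hypothesis Q_closed : closed Q.
Hypothesis Q_convex : forall x y (t : R), Q x -> Q y -> 0 <= t -> t <= 1 ->
  Q (t *: x + (1 - t) *: y).
Hypothesis zb_feasible : Q (G zb).
Hypothesis rho0 : 0 < rho.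
Hypothesis rob : forall y, `|y| < rho ->
  exists w q, [/\ `|w| <= 1, Q q & y = DG zb w - (q - G zb)].
Hypothesis pareto : loc_weak_pareto f G Q zb.

(** The left-hand sides are the [t^2] coefficients of [f i] and [G] along the parabola
    [zb + t d + t^2 w]. The negation is the infeasibility hypothesis of [multiplier_rule] for half
    Hessians. *)
Definition second_order_descent (d : Z) : Prop := exists w (s : R) q,
  [/\ 0 < s, Q q, forall i, Df i zb w + 2^-1 * D2f i zb d d < 0
    & DG zb w + 2^-1 *: D2G zb d d = s *: (q - G zb)].

Lemma DG_scale (a : R) v : DG zb (a *: v) = a *: DG zb v.
Proof.
have DG0 : DG zb 0 = 0.
  by apply: (@addrI _ (DG zb 0)); rewrite -{1}[DG zb 0]scale1r -(C2_linear G2) scaler0 !addr0.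
by rewrite -[a *: v]addr0 (C2_linear G2) DG0 addr0.
Qed.

Lemma no_descent_C01 d :
  C01 (fun i => Df i zb) (DG zb) Q (G zb) d -> ~ second_order_descent d.
Proof.
move=> [dfd [q1 [mu [Qq1 [mu0 DGd]]]]] [w [s [q [s0 Qq dfw DGw]]]].
have [epsP epsP0 opt] := pareto.
have G_cont : continuous G.
  by move=> z; have [/differentiable_continuous] := G2.1 z.
have [c [delta [c0 delta0 restore]]] := robinson_restoration G_cont
  (C2_strict_differentiable G2 zb) DG_scale (C2_bounded G2 zb) Q_closed Q_convex rho0 rob.
have Qseg p (a : R) : Q p -> 0 <= a -> a <= 1 -> Q (G zb + a *: (p - G zb)).
  move=> Qp a_ge0 a_le1; have := Q_convex Qp zb_feasible a_ge0 a_le1.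
  by rewrite scalerBl scale1r scalerBr addrCA.
(* The [f i] are finitely many, so one [e] serves them all, and then one [t]. *)
have descent : \forall e \near (0 : R)^'+, forall i,
    \forall t \near (0 : R)^'+, forall x,
    `|x - (zb + t *: (d + t *: w))| <= e * t ^+ 2 -> f i x < f i zb.
  by apply: filter_forall => i; apply: C2_descent (f2 i) (dfd i) (dfw i).
near (0 : R)^'+ => e.
have e0 : 0 < e by near: e; exact: nbhs_right_gt.
have desc : \forall t \near (0 : R)^'+, forall i x,
    `|x - (zb + t *: (d + t *: w))| <= e * t ^+ 2 -> f i x < f i zb.
  by apply: filter_forall; near: e.
(* Restoration multiplies the residual by [c], so a residual of [e / c * t^2] moves the point by at
   most [e t^2]. *)
have ec0 : 0 < e / c by rewrite divr_gt0.
have para := C2_parabola G2 zb d w ec0.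
near (0 : R)^'+ => t.
have t0 : 0 < t by near: t; exact: nbhs_right_gt.
have t20 : 0 < t ^+ 2 by rewrite exprn_gt0.
have tmu : t <= (2 * mu)^-1 by near: t; apply: nbhs_right_le; rewrite invr_gt0 mulr_gt0.
have ts : t <= (2 * s)^-1 by near: t; apply: nbhs_right_le; rewrite invr_gt0 mulr_gt0.
have t1 : t <= 1 by near: t; apply: nbhs_right_le.
have tt : t ^+ 2 <= t by rewrite expr2 ler_piMr// ltW.
have te : t <= epsP / 2 / e by near: t; apply: nbhs_right_le; rewrite !divr_gt0.
have td : t < delta / (e / c) by near: t; apply: nbhs_right_lt; rewrite divr_gt0.
have hd : `|t *: (d + t *: w)| < delta.
  by near: t; apply: (cvgr0_norm_lt _ (@parabola_cvg R Z d w)).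
have he : `|t *: (d + t *: w)| <= epsP / 2.
  by near: t; apply: (cvgr0_norm_le _ (@parabola_cvg R Z d w)); rewrite divr_gt0.
have parat : `|G (zb + t *: (d + t *: w)) - G zb - t *: DG zb d
     - t ^+ 2 *: (DG zb w + 2^-1 *: D2G zb d d)| <= e / c * t ^+ 2.
  by near: t.
have desct : forall i x,
    `|x - (zb + t *: (d + t *: w))| <= e * t ^+ 2 -> f i x < f i zb.
  by near: t.
set h := t *: (d + t *: w) in hd he parat desct.
pose qt := G zb + (t *: DG zb d + t ^+ 2 *: (s *: (q - G zb))).
(* [qt] is the midpoint of [G zb + 2 t mu (q1 - G zb)] and [G zb + 2 t^2 s (q - G zb)]. Both lie in
   [Q] by convexity, since [tmu] and [ts] keep the coefficients at most 1. *)
have Qqt : Q qt.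
  have Q1 : Q (G zb + (2 * (t * mu)) *: (q1 - G zb)).
    apply: Qseg => //; first by rewrite !mulr_ge0// ltW.
    have : t * (2 * mu) <= 1 by rewrite -ler_pdivlMr ?mulr_gt0// mul1r.
    lra.
  have Q2 : Q (G zb + (2 * (t ^+ 2 * s)) *: (q - G zb)).
    apply: Qseg => //; first by rewrite !mulr_ge0// ltW.
    have : t * (2 * s) <= 1 by rewrite -ler_pdivlMr ?mulr_gt0// mul1r.
    have := ler_wpM2r (ltW s0) tt; lra.
  have half0 : (0 : R) <= 2^-1 by rewrite invr_ge0.
  have half1 : (2^-1 : R) <= 1 by rewrite invf_le1// ler1n.
  have := Q_convex Q1 Q2 half0 half1.
  have -> : 1 - 2^-1 = 2^-1 :> R by field.
  have gg : 2^-1 *: (G zb + G zb) = G zb.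
    by rewrite scalerDr -scalerDl (_ : 2^-1 + 2^-1 = 1) ?scale1r//; field.
  rewrite -scalerDr addrACA scalerDr gg scalerDr !scalerA !mulKf//.
  by rewrite /qt DGd !scalerA.
have resid : `|G (zb + h) - qt| <= e / c * t ^+ 2.
  by move: parat; rewrite /qt DGw !opprD !addrA.
have residd : `|G (zb + h) - qt| < delta.
  apply: le_lt_trans resid _; rewrite mulrC -ltr_pdivlMr//.
  exact: le_lt_trans tt td.
have [|x QGx xh] := restore (zb + h) qt Qqt _ residd.
  by rewrite [zb + h]addrC addrK.
have {}xh : `|x - (zb + h)| <= e * t ^+ 2.
  apply: le_trans xh _; apply: le_trans (ler_wpM2l (ltW c0) resid) _.
  by rewrite mulrA [c * _]mulrC divfK ?gt_eqF//.
apply: (opt x QGx); last first.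
  by move=> i; rewrite subr_lt0; exact: desct xh.
have := ler_normD (x - (zb + h)) h.
have -> : x - (zb + h) + h = x - zb by rewrite opprD addrA subrK.
have : e * t ^+ 2 <= epsP / 2.
  by rewrite mulrC -ler_pdivlMr// (le_trans tt).
lra.
Unshelve. all: by end_near. Qed.

(* A descent direction at [d] can be corrected, using Robinson's condition, into
   one at any nearby [d'], so no weak* limit of multipliers is needed. *)
Lemma no_descent_C1star d :
  C1star (fun i => Df i zb) (DG zb) Q (G zb) d -> ~ second_order_descent d.
Proof.
move=> dcl [w [s [q [s0 Qq dfw DGw]]]].
have fhess i := @C2_hessian_continuous _ _ _ _ _ _ (f2 i) zb d.
have Ghess := C2_hessian_continuous G2 (z := zb) (x := d).
(* Moving [w] by [tau] times a vector of the unit ball uses at most half of the slack in each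
   inequality. *)
have lipschitz : \forall tau \near (0 : R)^'+, forall i v, `|v| <= 1 ->
    Df i zb (tau *: v) <= - (Df i zb w + 2^-1 * D2f i zb d d) / 2.
  apply: filter_forall => i; have [M MP] := C2_bounded (f2 i) zb.
  near=> tau => v v1.
  have tau0 : 0 < tau by near: tau; exact: nbhs_right_gt.
  apply: le_trans (ler_norm _) _; apply: le_trans (MP _) _.
  apply: le_trans (ler_wpM2r (normr_ge0 _) (ler_norm M)) _.
  apply: (@le_trans _ _ ((`|M| + 1) * tau)).
    rewrite normrZ (gtr0_norm tau0); apply: ler_pM => //.
    - by rewrite mulr_ge0// ltW.
    - by rewrite lerDl.
    - by rewrite ler_piMr// ltW.
  rewrite mulrC -ler_pdivlMr ?ltr_wpDl//.
  near: tau; apply: nbhs_right_le.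
  by rewrite !divr_gt0 ?oppr_gt0 ?ltr_wpDl.
near (0 : R)^'+ => tau.
have tau0 : 0 < tau by near: tau; exact: nbhs_right_gt.
have lip : forall i v, `|v| <= 1 ->
    Df i zb (tau *: v) <= - (Df i zb w + 2^-1 * D2f i zb d d) / 2.
  by near: tau.
(* After the factor 1/2, the change of the Hessian of [f i] uses less than the other half of the
   slack; that of [G] fits the Robinson ball scaled by [tau]. *)
have near_d : \forall d' \near d, `|D2G zb d d - D2G zb d' d'| < rho * tau /\
    forall i, D2f i zb d' d' - D2f i zb d d < - (Df i zb w + 2^-1 * D2f i zb d d).
  near=> d'; split.
    by near: d'; apply: (cvgr_dist_lt _ _ Ghess); rewrite mulr_gt0.
  near: d'; apply: filter_forall => i; near=> d'.
  apply: le_lt_trans (ler_norm _) _; rewrite distrC.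
  by near: d'; apply: (cvgr_dist_lt _ _ (fhess i)); rewrite oppr_gt0.
have [d' [Cd' [Gd' fd']]] := dcl _ near_d.
apply: (no_descent_C01 Cd').
(* Multiplied by [tau], this vector is half the change of the Hessian of [G], which the correction
   [tau w'] has to supply. The remainder [tau (q' - G zb)] then merges with [s (q - G zb)]. *)
have [|w' [q' [w'1 Qq' yE]]] := rob (y := (2 * tau)^-1 *: (D2G zb d d - D2G zb d' d')).
  rewrite normrZ gtr0_norm ?invr_gt0 ?mulr_gt0// mulrC ltr_pdivrMr ?mulr_gt0//.
  apply: lt_le_trans Gd' _; have := mulr_gt0 rho0 tau0; lra.
have [r Qr rE] := convex_ray_sum (G zb) Q_convex s0 tau0 Qq Qq'.
exists (w + tau *: w'), (s + tau), r; split => //.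
- by rewrite addr_gt0.
- move=> i.
  have -> : Df i zb (w + tau *: w') = Df i zb w + Df i zb (tau *: w').
    by rewrite -[w]scale1r (C2_linear (f2 i)) !scale1r.
  have := lip i w' w'1; have := fd' i; lra.
have -> : DG zb (w + tau *: w') = DG zb w + tau *: DG zb w'.
  by rewrite -DG_scale -[w]scale1r (C2_linear G2) !scale1r.
have DGw' : tau *: DG zb w' = 2^-1 *: (D2G zb d d - D2G zb d' d') + tau *: (q' - G zb).
  rewrite -[DG zb w'](subrK (q' - G zb)) -yE scalerDr scalerA invfM mulrCA.
  by rewrite divff ?gt_eqF// mulr1.
by rewrite -rE -DGw DGw' (scalerBr 2^-1) [_ - _ + _]addrAC addrA subrK addrA.
Unshelve. all: by end_near. Qed.
End NecessaryConditions.

(** * Second-order multipliers obtained from the primal condition *)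

Unset Implicit Arguments.
Set Strict Implicit.
Set Printing Implicit Defensive.

Theorem theorem3p1 (R : realType) (Z E : completeNormedModType R) (m : nat)
    (f : 'I_m -> Z -> R) (Df : 'I_m -> Z -> Z -> R)
    (D2f : 'I_m -> Z -> Z -> Z -> R)
    (G : Z -> E) (DG : Z -> Z -> E) (D2G : Z -> Z -> Z -> E)
    (Q : set E) (zb : Z) :
  (forall i, C2_with (f i) (Df i) (D2f i)) ->
  C2_with G DG D2G ->
  Q !=set0 -> closed Q -> convex_set Q ->
  feasible G Q zb ->
  robinson_cq (DG zb) Q (G zb) ->
  loc_weak_pareto f G Q zb ->
  forall d, C1star (fun i => Df i zb) (DG zb) Q (G zb) d ->
  exists lam : 'I_m -> R, exists e : E -> R,
    Lambda1 (fun i => Df i zb) (DG zb) Q (G zb) lam e /\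
    0 <= hess_L1 (fun i => D2f i zb) (D2G zb) lam e d d.
Proof.
move=> f2 G2 _ Q_closed Q_cvx zb_feas rcq pareto d dC.
have Q_convex x y (t : R) : Q x -> Q y -> 0 <= t -> t <= 1 ->
    Q (t *: x + (1 - t) *: y).
  move=> /mem_set Qx /mem_set Qy t0 t1.
  by have /set_mem := Q_cvx x y (Itv01 t0 t1) Qx Qy.
have /nbhs_norm0P[rho /= rho0 rob0] := rcq.
have rob y : `|y| < rho ->
    exists w q, [/\ `|w| <= 1, Q q & y = DG zb w - (q - G zb)].
  by move=> /rob0[w [q [w1 [Qq [_ yE]]]]]; exists w, q.
have infeas := no_descent_C1star f2 G2 Q_closed Q_convex zb_feas rho0 rob pareto dC.
(* The constants are half Hessian terms, so the excluded system is [second_order_descent d]; the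
   common factor 1/2 is divided out at the end. *)
have [lam [e [Lam hess]]] := multiplier_rule
  (A := fun i => Df i zb) (a := fun i => 2^-1 * D2f i zb d d)
  (fun i => C2_linear (f2 i) zb) (fun i => C2_bounded (f2 i) zb)
  (C2_linear G2 zb) Q_convex rho0 rob infeas.
exists lam, e; split => //.
have [_ [_ [_ [[eL _] _]]]] := Lam.
have e0 : e 0 = 0 by have := eL 1 0 0; rewrite scale1r addr0 mul1r; lra.
have eZ (a : R) y : e (a *: y) = a * e y by rewrite -[a *: y]addr0 eL e0 addr0.
move: hess; rewrite eZ; under eq_bigr do rewrite mulrCA.
by rewrite -mulr_sumr -mulrDr pmulr_rge0 ?invr_gt0.
Qed.
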